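(* Let $d\in\{2,3\}$, let $n\ge 3$, and let $T$ be an ordered set of distinct points $S_0,S_1,\ldots,S_n$ in $\mathbb{R}^d$ with position vectors $\mathbf{s}_0,\ldots,\mathbf{s}_n$. For integers $\ell\ge -1$ let $$\beta_\ell=\frac{(2+\sqrt3)^{\ell+1}-(2-\sqrt3)^{\ell+1}}{2\sqrt3}.$$ Define $$\mathbf{b}_0=\frac{3}{\beta_{n-1}-2\beta_n+(-1)^{n-1}}\Big(-\beta_n\mathbf{s}_0+\sum_{j=1}^n\big[(-1)^{j-1}\beta_{n-j}+(-1)^{n-j}\beta_{j-1}\big]\mathbf{s}_j\Big)$$ and, for $k=1,\ldots,n$, $$\mathbf{b}_k=\frac{\beta_{n-k}}{\beta_n}\Big[(-1)^k\mathbf{b}_0+6\sum_{j=1}^{k-1}(-1)^{k-j}\beta_{j-1}\mathbf{s}_j\Big]+\frac{\beta_{k-1}}{\beta_n}\Big[(-1)^{n+1-k}\mathbf{b}_0+6\sum_{j=k}^n(-1)^{j-k}\beta_{n-j}\mathbf{s}_j\Big].$$ Let $\mathscr{C}$ be the periodic uniform B-spline curve whose control points $B_0,\ldots,B_n$ have position vectors $\mathbf{b}_0,\ldots,\mathbf{b}_n$. Then $\mathscr{C}$ interpolates $T$, in the sense that its junction points are $S_0,S_1,\ldots,S_n,S_{n+1}=S_0$ in this order. Moreover, setting $\mathbf{b}_{n+1}=\mathbf{b}_0$ and $\mathbf{s}_{n+1}=\mathbf{s}_0$, $\mathscr{C}$ is composed of the cubic B\'ezier curves $\mathscr{C}_k$,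 $k=1,\ldots,n+1$, with control points $S_{k-1},P_{k-1},Q_k,S_k$, whose parametrizations $\mathbf{f}_k$ are given for $t\in[k-1,k]$ by $$\mathbf{f}_k(t)=(k-t)^3\mathbf{s}_{k-1}+3(t+1-k)(k-t)^2\mathbf{p}_{k-1}+3(t+1-k)^2(k-t)\mathbf{q}_k+(t+1-k)^3\mathbf{s}_k,$$ where $\mathbf{p}_k$ ($k=0,\ldots,n$) and $\mathbf{q}_k$ ($k=1,\ldots,n+1$) are the position vectors of $P_k$ and $Q_k$, respectively, and satisfy, for $k=1,\ldots,n+1$, $$\mathbf{p}_{k-1}=\tfrac23\mathbf{b}_{k-1}+\tfrac13\mathbf{b}_k,\qquad \mathbf{q}_k=\tfrac13\mathbf{b}_{k-1}+\tfrac23\mathbf{b}_k.$$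
   Context: Points are identified with their position vectors. The cubic B\'ezier curve with control points having position vectors $\mathbf{r}_0,\mathbf{r}_1,\mathbf{r}_2,\mathbf{r}_3$ is the curve parametrized on $[0,1]$ by $(1-t)^3\mathbf{r}_0+3t(1-t)^2\mathbf{r}_1+3t^2(1-t)\mathbf{r}_2+t^3\mathbf{r}_3$; it may be reparametrized on $[k-1,k]$ by replacing $t$ with $t+1-k$. Periodic uniform B-spline curve: given control points $B_0,\ldots,B_n$ ($n\ge3$) in $\mathbb{R}^d$ with position vectors $\mathbf{b}_0,\ldots,\mathbf{b}_n$, put $\mathbf{b}_{n+1}=\mathbf{b}_0$ and $\mathbf{b}_{n+2}=\mathbf{b}_1$. For $k=1,\ldots,n+1$ let $P_k$ and $Q_k$ be the points with position vectors $$\mathbf{p}_k=\tfrac23\mathbf{b}_k+\tfrac13\mathbf{b}_{k+1},\qquad \mathbf{q}_k=\tfrac13\mathbf{b}_{k-1}+\tfrac23\mathbf{b}_k,$$ and let the $k$-th junction point be the midpoint of $P_k$ and $Q_k$, i.e. the point with position vector $\boldsymbol{\sigma}_k=\frac{\mathbf{p}_k+\mathbf{q}_k}{2}$. Put $P_0=P_{n+1}$ (so $\mathbf{p}_0=\mathbf{p}_{n+1}=\tfrac23\mathbf{b}_0+\tfrac13\mathbf{b}_1$) and $\boldsymbol{\sigma}_0=\boldsymbol{\sigma}_{n+1}$. For $k=1,\ldots,n+1$ let $\mathscr{C}_k$ be the cubic B\'ezier curve whose control points have position vectors $\boldsymbol{\sigma}_{k-1},\mathbf{p}_{k-1},\mathbf{q}_k,\boldsymbol{\sigma}_k$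 (in this order). The curve obtained by joining $\mathscr{C}_1,\ldots,\mathscr{C}_{n+1}$ is the periodic uniform B-spline curve with control points $B_0,\ldots,B_n$. The statement that the curve interpolates $S_0,\ldots,S_n$ means that its junction points satisfy $\boldsymbol{\sigma}_k=\mathbf{s}_k$ for $k=0,\ldots,n$ (and $\boldsymbol{\sigma}_{n+1}=\mathbf{s}_0$), so that the curve passes through $S_0,\ldots,S_n$ in order and closes up at $S_0$. Empty sums are zero. *)

(* Defs.v *)
From HB Require Import structures.
From mathcomp Require Import all_boot all_order all_algebra reals.

Set Implicit Arguments.
Unset Strict Implicit.
Unset Printing Implicit Defensive.

Import Order.TTheory GRing.Theory Num.Theory.

Local Open Scope ring_scope.

(* Indices are read modulo n + 1: u_(n+1) = u_0, u_(n+2) = u_1. *)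
Definition cyc (n : nat) (V : Type) (u : 'I_n.+1 -> V) (k : nat) : V :=
  u (inZp k).

Definition cubic_bezier (R : realType) (d : nat) (r0 r1 r2 r3 : 'rV[R]_d)
    (t : R) : 'rV[R]_d :=
  (1 - t) ^+ 3 *: r0 + (3 * t * (1 - t) ^+ 2) *: r1
  + (3 * t ^+ 2 * (1 - t)) *: r2 + t ^+ 3 *: r3.

(* Because indices are cyclic, P_0 = P_(n+1). *)
Definition bspline_p (R : realType) (d n : nat) (b : 'I_n.+1 -> 'rV[R]_d)
    (k : nat) : 'rV[R]_d :=
  (2 / 3) *: cyc b k + (1 / 3) *: cyc b k.+1.

(* Only meaningful for k >= 1, since k.-1 is truncated at 0. *)
Definition bspline_q (R : realType) (d n : nat) (b : 'I_n.+1 -> 'rV[R]_d)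
    (k : nat) : 'rV[R]_d :=
  (1 / 3) *: cyc b k.-1 + (2 / 3) *: cyc b k.

Definition bspline_junction (R : realType) (d n : nat)
    (b : 'I_n.+1 -> 'rV[R]_d) (k : nat) : 'rV[R]_d :=
  let j := if k == 0%N then n.+1 else k in
  2^-1 *: (bspline_p b j + bspline_q b j).

(* The Bezier curve C_k for 1 <= k <= n + 1, with local parameter in [0, 1]. *)
Definition bspline_segment (R : realType) (d n : nat)
    (b : 'I_n.+1 -> 'rV[R]_d) (k : nat) : R -> 'rV[R]_d :=
  cubic_bezier (bspline_junction b k.-1) (bspline_p b k.-1)
               (bspline_q b k) (bspline_junction b k).

(* C_1, ..., C_(n+1) joined into one curve on [0, n + 1]. On [k - 1, k[ it is
   C_k, reparametrized by t + 1 - k; the last piece C_(n+1) also takes the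
   endpoint t = n + 1. Values outside [0, n + 1] are irrelevant. *)
Definition bspline_curve (R : realType) (d n : nat)
    (b : 'I_n.+1 -> 'rV[R]_d) (t : R) : 'rV[R]_d :=
  let k := (minn (Num.truncn t) n).+1 in
  bspline_segment b k (t + 1 - k%:R).

Definition bspline_interpolates (R : realType) (d n : nat)
    (b s : 'I_n.+1 -> 'rV[R]_d) : Prop :=
  forall k : nat, (k <= n.+1)%N -> bspline_junction b k = cyc s k.

(* Used for l >= -1 only. *)
Definition beta (R : realType) (l : int) : R :=
  ((2 + Num.sqrt 3) ^ (l + 1) - (2 - Num.sqrt 3) ^ (l + 1))
  / (2 * Num.sqrt 3).

Definition interp_b0 (R : realType) (d n : nat) (s : 'I_n.+1 -> 'rV[R]_d) :
    'rV[R]_d :=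
  (3 / (beta R (n%:Z - 1) - 2 * beta R n%:Z + (-1) ^+ (n - 1))) *:
  (- beta R n%:Z *: cyc s 0
   + \sum_(1 <= j < n.+1)
       ((-1) ^+ (j - 1) * beta R (n%:Z - j%:Z)
        + (-1) ^+ (n - j) * beta R (j%:Z - 1)) *: cyc s j).

Definition interp_bk (R : realType) (d n : nat) (s : 'I_n.+1 -> 'rV[R]_d)
    (k : nat) : 'rV[R]_d :=
  (beta R (n%:Z - k%:Z) / beta R n%:Z) *:
    ((-1) ^+ k *: interp_b0 s
     + 6 *: \sum_(1 <= j < k) ((-1) ^+ (k - j) * beta R (j%:Z - 1)) *: cyc s j)
  + (beta R (k%:Z - 1) / beta R n%:Z) *:
    ((-1) ^+ (n + 1 - k) *: interp_b0 s
     + 6 *: \sum_(k <= j < n.+1)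
              ((-1) ^+ (j - k) * beta R (n%:Z - j%:Z)) *: cyc s j).

Definition interp_control (R : realType) (d n : nat)
    (s : 'I_n.+1 -> 'rV[R]_d) (k : 'I_n.+1) : 'rV[R]_d :=
  if k == ord0 then interp_b0 s else interp_bk s k.

(* Main.v *)
Require Import Defs.
From HB Require Import structures.
From mathcomp Require Import all_boot all_order all_algebra reals.
From mathcomp Require Import ring lra zify.

Set Implicit Arguments.
Unset Strict Implicit.
Unset Printing Implicit Defensive.

Import Order.TTheory GRing.Theory Num.Theory.

Local Open Scope ring_scope.

(** Writing out the midpoint of P_k and Q_k, the junction point is
    sigma_k = (b_(k-1) + 4 b_k + b_(k+1)) / 6.  Interpolation is therefore the
    cyclic linear system b_(k-1) + 4 b_k + b_(k+1) = 6 s_k, k = 0, ..., n.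

    Put u_m = beta_(m-1) and N = n + 1.  Since 2 + sqrt 3 and 2 - sqrt 3 are
    the roots of x^2 = 4 x - 1, the sequence u satisfies u_0 = 0, u_1 = 1,
    u_(m+2) = 4 u_(m+1) - u_m, so that (-1)^k u_k and (-1)^k u_(N-k) solve the
    homogeneous equation and vanish at k = 0 and k = N respectively.  For a
    prescribed common value c = b_0 = b_N, the formula for b_k is the solution
    of the equations k = 1, ..., n by variation of constants from these two
    solutions: b_k = (u_(N-k) F_k + u_k G_k) / u_N, where F gathers the data to
    the left of k and G the data from k on.  Moving k by one changes the sign
    of F and G and adds one term [forward_dataS, backward_dataS]; in the
    combination b_(k-1) + 4 b_k + b_(k+1) everything cancels by the recurrence
    except 6 s_k (u_(k+1) u_(N-k) - u_k u_(N-k-1)) / u_N, which is 6 s_k by the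
    addition formula [betaN_add].  This is [dirichlet_interior].

    The remaining equation k = 0 is a linear equation for c alone, with
    coefficient 2 u_N - u_n + (-1)^n, up to a factor [dirichlet_closing].  It is
    nonzero because u increases strictly, and the formula for b_0 is the value
    of c that it dictates.

    The parametrization is then a matter of locating t: at an inner knot t = k
    the joined curve uses the piece C_(k+1) where the formula uses C_k, and both
    give s_k there. *)

(** * The sequence beta *)

(** The shift by one makes the sequence start at 0, and turns the integer
    indices of [beta] into natural numbers. *)
Definition betaN (R : realType) (m : nat) : R := beta R (m%:Z - 1).

Section BetaSequence.
Variable R : realType.
Local Notation u := (betaN R).

Lemma betaNE m :
  u m = ((2 + Num.sqrt 3) ^+ m - (2 - Num.sqrt 3) ^+ m) / (2 * Num.sqrt 3).
Proof. by rewrite /betaN /beta subrK. Qed.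

Lemma betaN0 : u 0 = 0.
Proof. by rewrite betaNE !expr0 subrr mul0r. Qed.

Lemma betaN1 : u 1 = 1.
Proof.
have s3 : Num.sqrt 3 != 0 :> R by rewrite sqrtr_eq0 -ltNge ltr0n.
by rewrite betaNE !expr1; field.
Qed.

Lemma betaNSS m : u m.+2 = 4 * u m.+1 - u m.
Proof.
rewrite !betaNE; set v := (2 * _)^-1.
have s3 : Num.sqrt 3 ^+ 2 = 3 :> R by rewrite sqr_sqrtr ?ler0n.
have step (x : R) : x ^+ 2 = 4 * x - 1 -> x ^+ m.+2 = 4 * x ^+ m.+1 - x ^+ m.
  by move=> hx; rewrite -addn2 exprD hx exprS; ring.
rewrite step; last by rewrite sqrrD s3; ring.
rewrite [(2 - _) ^+ m.+2]step; last by rewrite sqrrB s3; ring.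
by ring.
Qed.

Lemma betaN_ge0_lt m : 0 <= u m /\ u m < u m.+1.
Proof.
elim: m => [|m [ge0 lt]]; first by rewrite betaN0 betaN1 lexx ltr01.
by rewrite betaNSS; split; lra.
Qed.

Lemma betaN_gt0 m : 0 < u m.+1.
Proof. by have [ge0] := betaN_ge0_lt m; apply: le_lt_trans. Qed.

(** Both sides satisfy the recurrence in [k] and agree for [k = 0, 1]; this is
    the addition theorem of the hyperbolic sine in disguise. *)
Lemma betaN_add k m : u (k + m).+1 = u k.+1 * u m.+1 - u k * u m.
Proof.
suff: u (k + m).+1 = u k.+1 * u m.+1 - u k * u m /\
      u (k + m).+2 = u k.+2 * u m.+1 - u k.+1 * u m by case.
elim: k => [|k [IH0 IH1]].
  by rewrite add0n !betaNSS betaN0 betaN1; split; ring.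
split; first exact: IH1.
by rewrite addSn betaNSS IH0 IH1 (betaNSS k.+1) (betaNSS k); ring.
Qed.

(** From 1 <= u_(m+1) < u_(m+2) the first two terms exceed 1, so the sign term
    cannot cancel them. *)
Lemma closing_coef_gt0 m : 0 < 2 * u m.+2 - u m.+1 + (-1) ^+ m.+1.
Proof.
have [_ lt1] := betaN_ge0_lt m.+1.
have one_le : 1 <= u m.+1.
  elim: m {lt1} => [|m IH]; first by rewrite betaN1.
  by have [_] := betaN_ge0_lt m.+1; lra.
by have [-> | ->] : (-1) ^+ m.+1 = 1 :> R \/ (-1) ^+ m.+1 = -1 :> R;
  [rewrite -signr_odd; case: odd; [right | left] | lra | lra].
Qed.

End BetaSequence.

(** * The linear system with prescribed end values *)

Section DirichletSystem.
Variables (R : realType) (d N : nat) (c : 'rV[R]_d) (s : nat -> 'rV[R]_d).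
Local Notation u := (betaN R).

Definition forward_data (k : nat) : 'rV[R]_d :=
  (-1) ^+ k *: c + 6 *: \sum_(1 <= j < k) ((-1) ^+ (k - j) * u j) *: s j.

Definition backward_data (k : nat) : 'rV[R]_d :=
  (-1) ^+ (N - k) *: c
  + 6 *: \sum_(k <= j < N) ((-1) ^+ (j - k) * u (N - j)) *: s j.

(** The solution of b_(k-1) + 4 b_k + b_(k+1) = 6 s_k for 0 < k < N with
    b_0 = b_N = c. *)
Definition dirichlet_solution (k : nat) : 'rV[R]_d :=
  (u (N - k) / u N) *: forward_data k + (u k / u N) *: backward_data k.

Lemma forward_dataS k :
  forward_data k.+1 = - forward_data k - (6 * u k) *: s k.
Proof.
rewrite /forward_data; case: k => [|k].
  rewrite !big_geq // betaN0 !expr1 mulr0 scale0r !scaler0 scaleN1r.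
  by rewrite scale1r !addr0 subr0.
rewrite big_nat_recr //= subSnn expr1.
rewrite (eq_big_nat _ _ (F2 := fun j => - (((-1) ^+ (k.+1 - j) * u j) *: s j))).
  rewrite sumrN; apply/rowP => i; rewrite !mxE exprS.
  by ring.
by move=> j /andP[_ /ltnW lejk]; rewrite subSn // exprS mulN1r mulNr scaleNr.
Qed.

Lemma backward_dataS k : (k < N)%N ->
  backward_data k = - backward_data k.+1 + (6 * u (N - k)) *: s k.
Proof.
move=> ltkN; rewrite /backward_data big_ltn // subnn expr0 mul1r.
rewrite (eq_big_nat _ _
  (F2 := fun j => - (((-1) ^+ (j - k.+1) * u (N - j)) *: s j))).
  rewrite sumrN; apply/rowP => i; rewrite !mxE -[(N - k)%N]prednK ?subn_gt0 //.
  by rewrite -subnS exprS; ring.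
move=> j /andP[ltkj _]; rewrite -[(j - k)%N]prednK ?subn_gt0 // -subnS.
by rewrite exprS mulN1r mulNr scaleNr.
Qed.

Hypothesis N_gt0 : (0 < N)%N.

Let uN_neq0 : u N != 0.
Proof. by case: N N_gt0 => // m _; rewrite gt_eqF ?betaN_gt0. Qed.

Lemma dirichlet_left : dirichlet_solution 0 = c.
Proof.
rewrite /dirichlet_solution /forward_data big_geq // subn0 betaN0 mul0r scale0r.
by rewrite divff // expr0 !scale1r scaler0 !addr0.
Qed.

Lemma dirichlet_right : dirichlet_solution N = c.
Proof.
rewrite /dirichlet_solution /backward_data big_geq // subnn betaN0 mul0r.
by rewrite scale0r divff // expr0 !scale1r scaler0 addr0 add0r.
Qed.

(** Expressing all data by those at [k.+1], their coefficients vanish by the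
    recurrence, and the Wronskian-like coefficient left on [s k.+1] is
    evaluated by [betaN_add]. *)
Lemma dirichlet_interior k : (k.+1 < N)%N ->
  dirichlet_solution k + 4 *: dirichlet_solution k.+1 + dirichlet_solution k.+2
  = 6 *: s k.+1.
Proof.
move=> ltkN; have [m defN] : exists m, N = (k.+1 + m).+1.
  by exists (N - k.+2)%N; lia.
have uN := betaN_add R k.+1 m; rewrite -defN in uN.
have Nk : (N - k = m.+2)%N by lia.
have Nk1 : (N - k.+1 = m.+1)%N by lia.
have Nk2 : (N - k.+2 = m)%N by lia.
have Fk : forward_data k = - forward_data k.+1 - (6 * u k) *: s k.
  by rewrite forward_dataS opprD !opprK addrK.
have Gk := backward_dataS (ltnW ltkN); have Gk1 := backward_dataS ltkN.
have Gk2 : backward_data k.+2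
         = - backward_data k.+1 + (6 * u (N - k.+1)) *: s k.+1.
  by rewrite Gk1 opprD opprK subrK.
rewrite /dirichlet_solution Fk (forward_dataS k.+1) Gk Gk2 Nk Nk1 Nk2.
move: uN_neq0; rewrite uN => nz.
apply/rowP => i; rewrite !mxE.
rewrite (betaNSS R k) (betaNSS R m) in nz *.
by field.
Qed.

End DirichletSystem.

(** The alternating signs of b_1 and b_n combine so that both sums over the data
    run over the same range; what is left is a linear equation for [c]. *)
Lemma dirichlet_closing (R : realType) (d n : nat) (c : 'rV[R]_d)
    (s : nat -> 'rV[R]_d) : (0 < n)%N ->
  let u := betaN R in
  let b := dirichlet_solution n.+1 c s in
  u n.+1 *: (b n + 4 *: c + b 1%N)
  = (2 * (2 * u n.+1 - u n + (-1) ^+ n)) *: c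
    + 6 *: \sum_(1 <= j < n.+1)
        ((-1) ^+ (j - 1) * u (n.+1 - j)%N + (-1) ^+ (n - j) * u j) *: s j.
Proof.
move=> n_gt0 u b; have nz : u n.+1 != 0 by rewrite gt_eqF ?betaN_gt0.
under eq_bigr do rewrite scalerDl.
rewrite big_split /= [X in 6 *: (_ + X)]big_nat_recr //= subnn expr0 mul1r.
rewrite /b /dirichlet_solution /forward_data /backward_data.
rewrite subSnn subn1 /= -/u big_nat1 subnn subSnn [\sum_(1 <= j < 1) _]big_geq //.
rewrite /u !betaN1 -/u.
apply/rowP => i; rewrite !mxE /=.
by field.
Qed.

(** * The interpolating control polygon *)

Section Interpolation.
Variables (R : realType) (d n : nat) (s : 'I_n.+1 -> 'rV[R]_d).
Local Notation u := (betaN R).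

Lemma cyc_ord (V : Type) (v : 'I_n.+1 -> V) k (ltk : (k < n.+1)%N) :
  cyc v k = v (Ordinal ltk).
Proof. by congr v; apply: val_inj; rewrite /= modn_small. Qed.

Lemma cyc_wrap (V : Type) (v : 'I_n.+1 -> V) k : cyc v (n.+1 + k) = cyc v k.
Proof. by congr v; apply: val_inj; rewrite /= modnDl. Qed.

Lemma beta_sub_betaN k : (k <= n.+1)%N ->
  beta R (n%:Z - k%:Z) = u (n.+1 - k).
Proof. by move=> lek; rewrite /betaN -subzn // intS; congr beta; lia. Qed.

Lemma interp_bkE k : (k <= n.+1)%N ->
  interp_bk s k = dirichlet_solution n.+1 (interp_b0 s) (cyc s) k.
Proof.
move=> lek; rewrite /interp_bk /dirichlet_solution /forward_data /backward_data.
have -> : beta R n%:Z = u n.+1 by rewrite -(beta_sub_betaN (leq0n _)) subr0.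
rewrite beta_sub_betaN // addn1; congr (_ *: _ + _ *: (_ + _ *: _)).
by apply: eq_big_nat => j /andP[_ ltj]; rewrite beta_sub_betaN // ltnW.
Qed.

Lemma cyc_interp_control k : (k <= n.+1)%N ->
  cyc (interp_control s) k
  = dirichlet_solution n.+1 (interp_b0 s) (cyc s) k.
Proof.
case: (posnP k) => [->|k_gt0] lek.
  by rewrite dirichlet_left // cyc_ord /interp_control -val_eqE.
move: (lek); rewrite leq_eqVlt => /predU1P[->|ltk].
  rewrite dirichlet_right // -[in LHS](addn0 n.+1) cyc_wrap cyc_ord.
  by rewrite /interp_control -val_eqE.
by rewrite cyc_ord /interp_control -val_eqE /= gtn_eqF // interp_bkE.
Qed.

Lemma bspline_junctionE (b : 'I_n.+1 -> 'rV[R]_d) k :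
  let j := if k == 0%N then n.+1 else k in
  bspline_junction b k
  = 6^-1 *: (cyc b j.-1 + 4 *: cyc b j + cyc b j.+1).
Proof.
by apply/rowP => i; rewrite /bspline_junction /bspline_p /bspline_q !mxE; field.
Qed.

(** Up to the factor 2, this is the equation that [dirichlet_closing] imposes on
    the common end value. *)
Lemma interp_b0E : (0 < n)%N ->
  (2 * u n.+1 - u n + (-1) ^+ n) *: interp_b0 s
  = 3 *: (u n.+1 *: cyc s 0
    - \sum_(1 <= j < n.+1)
        ((-1) ^+ (j - 1) * u (n.+1 - j)%N + (-1) ^+ (n - j) * u j) *: cyc s j).
Proof.
move=> n_gt0.
have nz : 2 * u n.+1 - u n + (-1) ^+ n != 0.
  by rewrite gt_eqF //; case: n n_gt0 => // m _; apply: closing_coef_gt0.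
rewrite /interp_b0.
have -> : beta R n%:Z = u n.+1 by rewrite -(beta_sub_betaN (leq0n _)) subr0.
have -> : (-1) ^+ (n - 1) = - (-1) ^+ n :> R.
  by rewrite -[in RHS](prednK n_gt0) exprS subn1 mulN1r opprK.
rewrite -/(betaN R n) scalerA.
have -> : (2 * u n.+1 - u n + (-1) ^+ n)
          * (3 / (u n - 2 * u n.+1 - (-1) ^+ n)) = - 3.
  have -> : u n - 2 * u n.+1 - (-1) ^+ n
            = - (2 * u n.+1 - u n + (-1) ^+ n) by ring.
  by rewrite invrN mulrN mulrN mulrCA divff // mulr1.
rewrite (eq_big_nat _ _ (F2 := fun j =>
  ((-1) ^+ (j - 1) * u (n.+1 - j)%N + (-1) ^+ (n - j) * u j) *: cyc s j)).
  by apply/rowP => i; rewrite !mxE; ring.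
by move=> j /andP[_ ltj]; rewrite beta_sub_betaN // ltnW.
Qed.

Lemma interp_control_interpolates :
  (0 < n)%N -> bspline_interpolates (interp_control s) s.
Proof.
move=> n_gt0 k lek; rewrite bspline_junctionE /=.
have six : 6 != 0 :> R by rewrite pnatr_eq0.
(* The indices 0 and n + 1 both stand for the closing equation. *)
have [j0|] := boolP (k \in [:: 0%N; n.+1]); last first.
  rewrite !inE negb_or => /andP[k_neq0 k_neqN]; rewrite (negPf k_neq0).
  case: k k_neq0 k_neqN lek => // k _ k_neqN lek.
  have ltk : (k.+1 < n.+1)%N by rewrite ltn_neqAle k_neqN.
  rewrite /= !cyc_interp_control //; try by lia.
  by rewrite dirichlet_interior // scalerA mulVf ?scale1r.
have -> : (if k == 0%N then n.+1 else k) = n.+1.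
  by move: j0; rewrite !inE; case: eqP => //= _ /eqP.
have -> : cyc s k = cyc s 0.
  by move: j0; rewrite !inE => /pred2P[->//|->]; rewrite -[n.+1]addn0 cyc_wrap.
rewrite /= -[n.+2](addn1 n.+1) cyc_wrap !cyc_interp_control //.
rewrite dirichlet_right //.
have nz : u n.+1 != 0 by rewrite gt_eqF ?betaN_gt0.
apply: (scalerI six); rewrite scalerA mulfV // scale1r.
apply: (scalerI nz); rewrite dirichlet_closing // -scalerA interp_b0E //.
by apply/rowP => i; rewrite !mxE; ring.
Qed.

Lemma bspline_curve_piece (b : 'I_n.+1 -> 'rV[R]_d) k (t : R) :
  (1 <= k <= n.+1)%N -> k%:R - 1 <= t <= k%:R ->
  bspline_curve b t = bspline_segment b k (t + 1 - k%:R).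
Proof.
case: k => // k /andP[_ lek]; rewrite -natr1 addrK => /andP[let_ tle].
have [ltt|] := ltP t (k%:R + 1).
  have -> : t + 1 - (k%:R + 1) = t + 1 - k.+1%:R by rewrite natr1.
  have defk : Num.truncn t = k by apply: truncn_def; rewrite let_ -natr1.
  by rewrite /bspline_curve defk (minn_idPl _).
move=> tge; have -> : t = k.+1%:R.
  by rewrite -natr1; apply/eqP; rewrite eq_le tle tge.
rewrite /bspline_curve natrK natr1.
move: lek; rewrite leq_eqVlt => /predU1P[[->]|ltk].
  by rewrite (minn_idPr _).
(* At an inner knot the curve switches to the start of the next piece. *)
rewrite (minn_idPl _) // /bspline_segment /cubic_bezier -[k.+2%:R]natr1 /=.
by apply/rowP => i; rewrite !mxE; ring.
Qed.

End Interpolation.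

Theorem theorem2p2 (R : realType) (d n : nat) (s : 'I_n.+1 -> 'rV[R]_d)
    (hd : d = 2%N \/ d = 3%N) (hn : (3 <= n)%N) (hs : injective s) :
  let b := interp_control s in
  let p := bspline_p b in
  let q := bspline_q b in
  bspline_interpolates b s /\
  forall k : nat, (1 <= k <= n.+1)%N ->
    [/\ bspline_segment b k
          = cubic_bezier (cyc s (k - 1)) (p (k - 1)%N) (q k) (cyc s k),
        forall t : R, k%:R - 1 <= t <= k%:R ->
          bspline_curve b t
          = (k%:R - t) ^+ 3 *: cyc s (k - 1)
            + (3 * (t + 1 - k%:R) * (k%:R - t) ^+ 2) *: p (k - 1)%N
            + (3 * (t + 1 - k%:R) ^+ 2 * (k%:R - t)) *: q k
            + (t + 1 - k%:R) ^+ 3 *: cyc s k,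
        p (k - 1)%N = (2 / 3) *: cyc b (k - 1) + (1 / 3) *: cyc b k
      & q k = (1 / 3) *: cyc b (k - 1) + (2 / 3) *: cyc b k].
Proof.
move=> b p q.
have interp : bspline_interpolates b s.
  by apply: interp_control_interpolates; apply: leq_trans hn.
split; first exact: interp.
move=> k hk; have /andP[k_gt0 lek] := hk.
have seg : bspline_segment b k
         = cubic_bezier (cyc s (k - 1)) (p (k - 1)%N) (q k) (cyc s k).
  rewrite subn1 /bspline_segment (interp k lek).
  by rewrite (interp k.-1 (leq_trans (leq_pred k) lek)).
split; first exact: seg.
- move=> t ht; rewrite (bspline_curve_piece b hk ht) seg /cubic_bezier.
  by have -> : 1 - (t + 1 - k%:R) = k%:R - t by ring.
- by rewrite /p /bspline_p subn1 prednK.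
- by rewrite /q /bspline_q subn1.
Qed.
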